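(* Let $p(y,s,m)=p(m)\prod_{k=1}^K p(y_k,s_k\mid m_k=1)^{m_k}$ be a mixture model over $K$ normalized models, and let $q(s,m)=q(m)\prod_{k=1}^K q(s_k\mid m_k=1)^{m_k}$ be a variational posterior of the same form. For observed $y=\hat y$, the variational free energy $$\mathrm F[q]=\mathbb E_{q(s,m)}\left[\ln\frac{q(s,m)}{p(y=\hat y,s,m)}\right]$$ satisfies $$\mathrm F[q]=\mathbb E_{q(m)}\left[\ln\frac{q(m)}{p(m)}\right]+\mathbb E_{q(m)}\left[\prod_{k=1}^K\big(\mathrm F_k[q]\big)^{m_k}\right]=\mathbb E_{q(m)}\left[\ln\frac{q(m)}{p(m)\,f_m(m)}\right],$$ where $$\mathrm F_k[q]=\mathbb E_{q(s_k\mid m_k=1)}\left[\ln\frac{q(s_k\mid m_k=1)}{p(y_k=\hat y_k,s_k\mid m_k=1)}\right],\qquad f_m(m)=\prod_{k=1}^K\exp(-\mathrm F_k[q])^{m_k}.$$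
   Context: The model selection variable $m=(m_1,\dots,m_K)$ is a one-of-$K$ binary vector: $m_k\in\{0,1\}$ and $\sum_{k=1}^K m_k=1$; $p(m)$ and $q(m)$ are probability mass functions on such vectors. The $k$-th model $p(y_k,s_k\mid m_k=1)$ is a joint density of its observed variables $y_k$ and latent variables $s_k$; $y=\bigcup_k y_k$, $s=\bigcup_k s_k$, and $\hat y_k$ is the restriction of $\hat y$ to $y_k$. Each $q(s_k\mid m_k=1)$ is a probability density on $s_k$. Expectations under $q(s,m)=q(m)\prod_k q(s_k\mid m_k=1)^{m_k}$ are taken by drawing $m$ from $q(m)$ and then, when $m_k=1$, drawing $s_k$ from $q(s_k\mid m_k=1)$. A factor raised to the power $m_k=0$ equals $1$. All expectations are assumed to be well-defined and finite. Integrals are replaced by sums for discrete variables. *)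

(* Defs.v *)
From HB Require Import structures.
From mathcomp Require Import all_boot all_order all_algebra.
From mathcomp Require Import all_classical all_reals all_analysis.

Set Implicit Arguments.
Unset Strict Implicit.
Unset Printing Implicit Defensive.

Import Order.TTheory GRing.Theory Num.Theory.

Local Open Scope classical_set_scope.
Local Open Scope ring_scope.

(* Conventions for densities and logarithms.  Densities are taken with respect
   to an arbitrary sigma-finite reference measure, so that Lebesgue measures
   (integrals), counting measures (sums) and their products are all covered.
   Logarithms of ratios are [lne] of an extended-real quotient: a / 0 = +oo for
   a > 0 and [lne +oo = +oo], so a vanishing denominator is not silently
   replaced by a junk finite value; values on events of weight 0 do not matter
   since 0 * x = 0 in [\bar R]. *)

Section config.
Context (I : finType) (d : I -> measure_display)
  (T : forall i, measurableType (d i)) (A : {set I}).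

(* Joint values of the variables whose index is in [A], with the product
   sigma-algebra (generated by the coordinates). *)
Definition config : Type := forall i : {i | i \in A}, T (sval i).

Definition config_cylinders : set (set config) :=
  [set B | exists (i : {i | i \in A}) (C : set (T (sval i))),
     measurable C /\ B = [set x : config | C (x i)]].

HB.instance Definition _ :=
  Pointed.copy config (forall i : {i | i \in A}, T (sval i)).
HB.instance Definition _ :=
  Measurable.copy config (g_sigma_algebraType config_cylinders).

Definition restrict_config (x : forall i, T i) : config := fun i => x (sval i).

Definition override_config (x0 : forall i, T i) (x : config) : forall i, T i :=
  fun i => if @idP (i \in A) is ReflectT iA then x (exist _ i iA) else x0 i.

End config.

Arguments restrict_config {I d T} A x.

(* One-of-K binary vectors; [bit m k] is used as an exponent through the
   coercion of [bool] to [nat]. *)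
Definition onehot (K : nat) : finType :=
  {m : {ffun 'I_K -> bool} | (\sum_k m k == 1)%N}.

Definition bit (K : nat) (m : onehot K) (k : 'I_K) : bool := val m k.

Section expectations.
Context (R : realType).

Definition is_pmf (T : finType) (f : T -> R) : Prop :=
  (forall x, 0 <= f x) /\ \sum_x f x = 1.

Definition is_density d (T : measurableType d)
    (mu : {measure set T -> \bar R}) (f : T -> R) : Prop :=
  [/\ measurable_fun [set: T] f, forall x, 0 <= f x
    & (\int[mu]_x (f x)%:E = 1)%E].

Local Open Scope ereal_scope.

Definition pmf_expectation (T : finType) (f : T -> R) (g : T -> \bar R) :
    \bar R :=
  \sum_x (f x)%:E * g x.

Definition density_expectation d (T : measurableType d)
    (mu : {measure set T -> \bar R}) (f : T -> R) (g : T -> \bar R) : \bar R :=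
  \int[mu]_x ((f x)%:E * g x).

(* In [pmf_finite] every term is required to be finite: a finite sum of extended
   reals is well-defined and finite exactly in this case. *)
Definition pmf_finite (T : finType) (f : T -> R) (g : T -> \bar R) : Prop :=
  forall x, (f x)%:E * g x \is a fin_num.

Definition density_finite d (T : measurableType d)
    (mu : {measure set T -> \bar R}) (f : T -> R) (g : T -> \bar R) : Prop :=
  mu.-integrable [set: T] (fun x => (f x)%:E * g x).

Definition log_ratio (a b : \bar R) : \bar R := lne (a / b).

End expectations.

Section mixture.
Context (R : realType) (K : nat).
Context (Y : finType) (dY : Y -> measure_display)
  (TY : forall v, measurableType (dY v)) (yvars : 'I_K -> {set Y}).
Context (S : finType) (dS : S -> measure_display)
  (TS : forall v, measurableType (dS v)) (svars : 'I_K -> {set S}).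
Context (mu : forall k,
  {sigma_finite_measure set (config TS (svars k)) -> \bar R}).

Context (pm : onehot K -> R)
  (p : forall k, config TY (yvars k) * config TS (svars k) -> R).
Context (qm : onehot K -> R) (q : forall k, config TS (svars k) -> R).

Definition mixture_joint (y : forall v, TY v) (s : forall v, TS v)
    (m : onehot K) : R :=
  pm m * \prod_k
    @p k (restrict_config (yvars k) y, restrict_config (svars k) s) ^+ bit m k.

Definition posterior_joint (s : forall v, TS v) (m : onehot K) : R :=
  qm m * \prod_k @q k (restrict_config (svars k) s) ^+ bit m k.

Local Open Scope ereal_scope.

(* Expectation under q(s, m): draw m, then draw s_k for the k with m_k = 1 (the
   inner sum has exactly one term).  The latent variables outside s_k are not
   drawn; they are given the placeholder values [s0]. *)
Definition posterior_expectation (s0 : forall v, TS v)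
    (g : (forall v, TS v) -> onehot K -> \bar R) : \bar R :=
  pmf_expectation qm (fun m =>
    \sum_(k | bit m k)
      density_expectation (mu k) (@q k) (fun sk =>
        g (override_config s0 sk) m)).

Definition free_energy (s0 : forall v, TS v) (y : forall v, TY v) : \bar R :=
  posterior_expectation s0 (fun s m =>
    log_ratio (posterior_joint s m)%:E (mixture_joint y s m)%:E).

Definition model_log_ratio (y : forall v, TY v) (k : 'I_K)
    (sk : config TS (svars k)) : \bar R :=
  log_ratio (q sk)%:E (p (restrict_config (yvars k) y, sk))%:E.

Definition model_free_energy (y : forall v, TY v) (k : 'I_K) : \bar R :=
  density_expectation (mu k) (@q k) (model_log_ratio y (k := k)).

Definition model_message (y : forall v, TY v) (m : onehot K) : \bar R :=
  \prod_k expeR (- model_free_energy y k) ^+ bit m k.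

End mixture.

(* Main.v *)
Require Import Defs.
From HB Require Import structures.
From mathcomp Require Import all_boot all_order all_algebra.
From mathcomp Require Import all_classical all_reals all_analysis.

Import Order.TTheory GRing.Theory Num.Theory.

Local Open Scope classical_set_scope.
Local Open Scope ring_scope.
Local Open Scope ereal_scope.

(* Once [m] is drawn, both joint densities reduce to a product of a factor of
   [m] and a factor of the single selected model [k], so the log-ratio splits as
   ln (q(m) / p(m)) + ln (q(s_k) / p(y_k, s_k)); averaging over [s_k], whose
   density has mass 1, gives ln (q(m) / p(m)) + F_k.  Events of weight 0 are set
   apart: finiteness of the first term forces p(m) > 0 as soon as q(m) > 0, while
   p(y_k, s_k) may vanish where q(s_k) > 0, both sides being then +oo. *)

(** A sum of naturals equals 1 only if one term is 1 and the others are 0. The passage through a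
    boolean [exists] lets choice turn mere existence into a [sig] witness. *)
Lemma bit_onehot {K : nat} (m : onehot K) :
  {k : 'I_K | forall j, bit m j = (j == k)}.
Proof.
suff /existsP/sigW[k /forallP km] : [exists k, forall j, bit m j == (j == k)].
  by exists k => j; exact/eqP.
have /sum_nat_eq1[k [_ mk mj]] : (\sum_k bit m k == 1)%N := valP m.
apply/existsP; exists k; apply/forallP => j.
have [->|jk] := eqVneq j k; first by move: mk; case: bit.
by move: (mj j jk isT); case: bit.
Qed.

Lemma prodr_bit {R : pzSemiRingType} {K : nat} {m : onehot K} {k : 'I_K}
    (F : 'I_K -> R) :
  (forall j, bit m j = (j == k)) -> (\prod_j F j ^+ bit m j = F k)%R.
Proof.
move=> mk; rewrite -[RHS](@big_pred1_eq _ _ *%R%R _ k) big_mkcond.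
by apply: eq_bigr => j _; rewrite mk; case: eqP.
Qed.

(** A separate version for extended reals, which do not form a semiring: multiplication does not
    distribute over every sum. *)
Lemma prode_bit {R : realType} {K : nat} {m : onehot K} {k : 'I_K}
    (F : 'I_K -> \bar R) :
  (forall j, bit m j = (j == k)) -> \prod_j F j ^+ bit m j = F k.
Proof.
move=> mk; rewrite -[RHS](@big_pred1_eq _ _ *%E _ k) big_mkcond.
by apply: eq_bigr => j _; rewrite mk; case: eqP.
Qed.

(** This makes the placeholder [x0] invisible to a model that reads only variables in [A]. *)
Lemma override_configK (I : finType) (d : I -> measure_display)
    (T : forall i, measurableType (d i)) (A : {set I}) (x0 : forall i, T i) :
  cancel (@override_config I d T A x0) (restrict_config A).
Proof.
move=> x; apply: functional_extensionality_dep => -[i iA].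
rewrite /restrict_config /override_config /=.
(* The case analysis yields its own membership proof [iA'], which must be identified with [iA]. *)
case: {-}_ / idP => [iA'|/(_ iA)//].
by rewrite (bool_irrelevance iA' iA).
Qed.

Section log_ratio.
Context {R : realType}.
Implicit Types (a b c d : R) (x : \bar R).

Lemma log_ratio_EFin {a b} : (0 < a)%R -> (0 < b)%R ->
  log_ratio a%:E b%:E = (ln a - ln b)%:E.
Proof.
move=> a0 b0; rewrite /log_ratio inver gt_eqF// -EFinM lne_EFin ?divr_gt0//.
by rewrite ln_div.
Qed.

Lemma log_ratio0 {a} : (0 < a)%R -> log_ratio a%:E 0 = +oo.
Proof. by move=> a0; rewrite /log_ratio inve0 gt0_muley ?lte_fin. Qed.

Lemma log_ratioM {a b c d} : (0 < a)%R -> (0 < b)%R -> (0 < c)%R ->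
    (0 <= d)%R ->
  log_ratio (a * c)%:E (b * d)%:E = log_ratio a%:E b%:E + log_ratio c%:E d%:E.
Proof.
move=> a0 b0 c0; rewrite le_eqVlt => /predU1P[<-|d0].
  by rewrite mulr0 !log_ratio0 ?mulr_gt0// log_ratio_EFin.
rewrite !log_ratio_EFin ?mulr_gt0// !lnM// -EFinD.
by rewrite opprD addrACA.
Qed.

(** With [x] equal to F_k, this takes the message f_m out of the logarithm and so links the two
    forms of the free energy. *)
Lemma log_ratio_expeR {a b x} : (0 < a)%R -> (0 < b)%R -> x \is a fin_num ->
  log_ratio a%:E (b%:E * expeR (- x)) = log_ratio a%:E b%:E + x.
Proof.
move=> a0 b0; case: x => // r _ /=.
rewrite -EFinM !log_ratio_EFin ?mulr_gt0 ?expR_gt0//.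
by rewrite lnM ?posrE ?expR_gt0// expRK opprD opprK addrA.
Qed.

Lemma log_ratio_fin_denom_gt0 {a b} : (0 < a)%R -> (0 <= b)%R ->
  a%:E * log_ratio a%:E b%:E \is a fin_num -> (0 < b)%R.
Proof.
move=> a0; rewrite le_eqVlt => /predU1P[<-|//].
by rewrite log_ratio0// gt0_muley ?lte_fin.
Qed.

End log_ratio.

Lemma is_density_integrable {R : realType} {d} {T : measurableType d}
    {mu : {measure set T -> \bar R}} {f : T -> R} :
  is_density mu f -> mu.-integrable setT (EFin \o f).
Proof.
move=> [mf f0 f1]; apply/integrableP; split; first exact/measurable_realfun.measurable_EFinP.
rewrite (eq_integral (EFin \o f)) ?f1 ?ltry// => x _.
by rewrite /= ger0_norm.
Qed.

Lemma density_expectationDl {R : realType} {d} {T : measurableType d}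
    {mu : {measure set T -> \bar R}} {f : T -> R} {g : T -> \bar R} (r : R) :
  is_density mu f -> density_finite mu f g ->
  density_expectation mu f (fun x => r%:E + g x)
  = r%:E + density_expectation mu f g.
Proof.
move=> df fg; have intf := is_density_integrable df.
rewrite /density_expectation.
(* [g x] may be infinite; distributing is sound because [r] is finite, so the sum is never of the
   form +oo - oo. *)
under eq_integral do rewrite muleDr ?fin_num_adde_defr//.
rewrite integralD//=; last exact: integrableZr intf.
by rewrite integralZr//; case: df => _ _ ->; rewrite mul1e.
Qed.

Theorem mainTheorem3 (R : realType) (K : nat)
  (Y : finType) (dY : Y -> measure_display)
  (TY : forall v : Y, measurableType (dY v)) (yvars : 'I_K -> {set Y})
  (yvars_cover : (\bigcup_(k < K) yvars k)%SET = [set: Y]%SET)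
  (S : finType) (dS : S -> measure_display)
  (TS : forall v : S, measurableType (dS v)) (svars : 'I_K -> {set S})
  (svars_cover : (\bigcup_(k < K) svars k)%SET = [set: S]%SET)
  (nu : forall k : 'I_K,
    {sigma_finite_measure set (config TY (yvars k)) -> \bar R})
  (mu : forall k : 'I_K,
    {sigma_finite_measure set (config TS (svars k)) -> \bar R})
  (pm : onehot K -> R) (pm_pmf : is_pmf pm)
  (p : forall k : 'I_K, config TY (yvars k) * config TS (svars k) -> R)
  (p_density : forall k : 'I_K, is_density (nu k \x mu k) (p k))
  (qm : onehot K -> R) (qm_pmf : is_pmf qm)
  (q : forall k : 'I_K, config TS (svars k) -> R)
  (q_density : forall k : 'I_K, is_density (mu k) (q k))
  (y : forall v : Y, TY v) (s0 : forall v : S, TS v)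
  (qm_finite : pmf_finite qm (fun m => log_ratio (qm m)%:E (pm m)%:E))
  (q_finite : forall k : 'I_K,
    density_finite (mu k) (q k) (model_log_ratio p q y (k := k))) :
  free_energy mu pm p qm q s0 y
    = pmf_expectation qm (fun m => log_ratio (qm m)%:E (pm m)%:E)
      + pmf_expectation qm (fun m =>
          \prod_(k < K) model_free_energy mu p q y k ^+ bit m k)
  /\
  free_energy mu pm p qm q s0 y
    = pmf_expectation qm (fun m =>
        log_ratio (qm m)%:E ((pm m)%:E * model_message mu p q y m)).
Proof.
have [qm0 _] := qm_pmf; have [pm0 _] := pm_pmf.
have F_fin k : model_free_energy mu p q y k \is a fin_num.
  exact: (integrable_fin_num _ (q_finite k)).
(* The three expectations agree already term by term in [m]: the middle expression is the summand of
   the first form, and the last one that of the second. *)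
have term m : (qm m)%:E * \sum_(k | bit m k)
      density_expectation (mu k) (q k) (fun sk =>
        log_ratio (posterior_joint qm q (override_config s0 sk) m)%:E
          (mixture_joint pm p y (override_config s0 sk) m)%:E)
    = (qm m)%:E * log_ratio (qm m)%:E (pm m)%:E
      + (qm m)%:E * \prod_(k < K) model_free_energy mu p q y k ^+ bit m k
  /\ (qm m)%:E * log_ratio (qm m)%:E (pm m)%:E
      + (qm m)%:E * \prod_(k < K) model_free_energy mu p q y k ^+ bit m k
    = (qm m)%:E * log_ratio (qm m)%:E ((pm m)%:E * model_message mu p q y m).
  have [qm_eq0|qm_neq0] := eqVneq (qm m) 0%R.
    by rewrite qm_eq0 !mul0e adde0.
  have qm_gt0 : (0 < qm m)%R by rewrite lt_neqAle eq_sym qm_neq0 qm0.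
  have pm_gt0 := log_ratio_fin_denom_gt0 qm_gt0 (pm0 m) (qm_finite m).
  have [k mk] := bit_onehot m.
  rewrite /model_message !(prode_bit _ mk) log_ratio_expeR//.
  (* Writing the log-ratio as a real number justifies factoring out the weight q(m), and provides
     the constant [r] for [density_expectationDl]. *)
  rewrite log_ratio_EFin// -muleDr//; split=> //; congr (_ * _).
  (* Only the selected [k] survives in the inner sum; moving the constant under the integral leaves
     a pointwise comparison of integrands. *)
  rewrite (eq_bigl _ _ mk) big_pred1_eq -(density_expectationDl _ (q_density k))//.
  apply: eq_integral => s _.
  have [_ /(_ s) q_ge0 _] := q_density k.
  have [->|q_neq0] := eqVneq (q k s) 0%R; first by rewrite !mul0e.
  have q_gt0 : (0 < q k s)%R by rewrite lt_neqAle eq_sym q_neq0.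
  have [_ p_ge0 _] := p_density k.
  rewrite /posterior_joint /mixture_joint !(prodr_bit _ mk) override_configK.
  by rewrite log_ratioM// log_ratio_EFin.
split.
  rewrite /free_energy /posterior_expectation /pmf_expectation -big_split /=.
  by apply: eq_bigr => m _; have [] := term m.
by apply: eq_bigr => m _; have [-> ->] := term m.
Qed.
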